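(* Let $\{X_\alpha : \alpha\in A\}$ be a family of totally countably pracompact $T_1$ topological spaces. Then the product $X=\prod_{\alpha\in A}X_\alpha$ (with the Tychonoff product topology) is totally countably pracompact, and every $\Sigma$-product of the family $\{X_\alpha : \alpha\in A\}$ is totally countably pracompact.
   Context: A topological space $X$ is totally countably pracompact if it contains a dense subset $D$ such that each sequence of points of $D$ has a subsequence whose set of terms has compact closure in $X$. Here ''compact'' means that each open cover has a finite subcover (no separation axiom is included). Let $X=\prod_{\alpha\in A}X_\alpha$. A $\Sigma$-product of the family $\{X_\alpha\}$ is a subspace $Y\subset X$ (with the subspace topology) for which there exists a point $y=(y_\alpha)\in X$ such that $Y=\{x\in X : x_\alpha=y_\alpha \text{ for all but countably many } \alpha\in A\}$. *)

(* Defs.v *)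
From mathcomp Require Import all_boot.
From mathcomp Require Import boolp classical_sets functions cardinality.
From mathcomp Require Import topology.

Set Implicit Arguments.
Unset Strict Implicit.
Unset Printing Implicit Defensive.

Local Open Scope classical_set_scope.

Definition totally_countably_pracompact (X : topologicalType) : Prop :=
  exists2 D : set X, dense D &
    forall u : nat -> X, (forall n, D (u n)) ->
      exists2 phi : nat -> nat, {homo phi : m n / (m < n)%N} &
        cover_compact (closure (range (u \o phi))).

Definition is_sigma_product (A : Type) (X : A -> topologicalType)
    (Y : set (prod_topology X)) : Prop :=
  exists y : prod_topology X, Y = [set x | countable [set a | x a <> y a]].

(* Main.v *)
(** Fix a point y and dense sets D_a in the factors. The points x that differ
    from y in countably many coordinates only, and satisfy x_a = y_a or x_a in
    D_a for every a, form a dense set, both in the product and in the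
    Sigma-product around y. A sequence of such points is constant in all but
    countably many coordinates; in each of these, some subsequence lies in a
    closed compact set (T1 makes {y_a} closed). A diagonal subsequence lies in
    these sets up to finitely many terms, which T1 allows to be adjoined. The
    resulting box of closed compact sets is compact by Tychonoff, and it is
    contained in the Sigma-product, as all but countably many of its sides are
    {y_a}. *)
Require Import Defs.
From HB Require Import structures.
From mathcomp Require Import all_boot.
From mathcomp Require Import boolp classical_sets functions cardinality.
From mathcomp Require Import topology.

Set Implicit Arguments.
Unset Strict Implicit.
Unset Printing Implicit Defensive.

Local Open Scope classical_set_scope.

(* [compact_cover] is only available for pointed spaces. *)
Lemma compact_iff_cover_compact (T : topologicalType) (K : set T) :
  compact K <-> cover_compact K.
Proof.
have [->|/set0P[x _]] := eqVneq K set0.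
  by split=> _; [move=> I D f _ _; exists finmap.fset0|exact: compact0].
(* A point of [K] makes [T] pointed without changing its topology. *)
pose pT : ptopologicalType := HB.pack_for ptopologicalType T (isPointed.Build T x).
have e : @compact pT K = @cover_compact pT K by rewrite compact_cover.
exact: (eq_ind _ (fun Q => @compact pT K <-> Q) (iff_refl _) _ e).
Qed.

(** A filter on [Y] is pushed forward to [T]; its cluster point in [K] lies in [Y], whose open sets
    are traces of open sets of [T]. *)
Lemma compact_set_val (T : topologicalType) (Y K : set T) :
  K `<=` Y -> compact K -> compact (set_val @^-1` K : set Y).
Proof.
move=> KY cK F FF FK.
have [p [Kp Fp]] := cK (set_val @ F) _ FK.
have Yp : p \in Y by rewrite inE; exact: KY.
exists (exist _ p Yp : Y); split => //= B C FB [_ [[O oO <-] Op] OC].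
have /Fp : (set_val @ F) (set_val @` B).
  by rewrite /= /nbhs /=; apply: filterS FB => z Bz; exists z.
move=> /(_ O (open_nbhs_nbhs (conj oO Op)))[_ [[z Bz <-] Oz]].
by exists z; split => //; exact: OC.
Qed.

Lemma homo_ltn_geid (phi : nat -> nat) :
  {homo phi : m n / (m < n)%N} -> forall n, (n <= phi n)%N.
Proof.
by move=> phiS; elim=> // n IH; exact: leq_ltn_trans IH (phiS _ _ (ltnSn n)).
Qed.

Lemma frequently_subsequence (P : nat -> Prop) :
  (forall N, exists n, (N <= n)%N /\ P n) ->
  exists2 phi : nat -> nat, {homo phi : m n / (m < n)%N} & forall n, P (phi n).
Proof.
move=> /choice[f fP].
exists (fix phi n := if n is m.+1 then f (phi m).+1 else f 0%N).
  by apply: homo_ltn => [|n]; [exact: ltn_trans|exact: (fP _).1].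
by case=> [|n]; apply: (fP _).2.
Qed.

Lemma diagonal_subsequence (P : nat -> (nat -> nat) -> Prop) :
  (forall k phi, {homo phi : m n / (m < n)%N} ->
    exists2 psi : nat -> nat, {homo psi : m n / (m < n)%N} & P k (phi \o psi)) ->
  exists2 theta : nat -> nat, {homo theta : m n / (m < n)%N} &
    forall k, exists2 phi, P k phi &
      forall n, (k < n)%N -> range phi (theta n).
Proof.
move=> Pex.
(* Monotonicity is a premise inside the choice, so that [s] is total; [id] is a dummy value. *)
have /choice[s sP] : forall kphi : nat * (nat -> nat), exists psi : nat -> nat,
    {homo kphi.2 : m n / (m < n)%N} ->
    {homo psi : m n / (m < n)%N} /\ P kphi.1 (kphi.2 \o psi).
  move=> [k phi]; have [/(Pex k)[psi]|] := pselect {homo phi : m n / (m < n)%N}.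
    by exists psi.
  by exists id.
pose Phi := fix Phi k := if k is j.+1 then Phi j \o s (j, Phi j) else id.
have PhiS k : {homo Phi k : m n / (m < n)%N}.
  elim: k => //= k IH m n mn; apply: (IH).
  by have [+ _] := sP (k, Phi k) IH; exact.
have sS k := (sP (k, Phi k) (PhiS k)).1.
have PhiP k := (sP (k, Phi k) (PhiS k)).2.
have Phi_range j k : (j <= k)%N -> range (Phi k) `<=` range (Phi j).
  elim: k => [|k IH]; first by rewrite leqn0 => /eqP->.
  rewrite leq_eqVlt => /predU1P[->//|/IH]; apply: subset_trans.
  by move=> _ [n _ <-]; exists (s (k, Phi k) n).
exists (fun n => Phi n n).
  apply: homo_ltn => [|n]; first exact: ltn_trans.
  by apply: PhiS; apply: homo_ltn_geid.
(* [Phi 0] is [id], so [P k] is first secured by [Phi k.+1], whose range contains the diagonal from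
   index [k.+1] on. *)
move=> k; exists (Phi k.+1) => [|n kn]; first exact: PhiP.
by apply: (Phi_range _ n) => //; exists n.
Qed.

(** Either [u] takes the value [y] infinitely often, giving a constant subsequence, or a tail of [u]
    lies in [D]. *)
Lemma add_point_compact_subsequence (T : topologicalType) (D : set T) (y : T) :
  accessible_space T ->
  (forall u : nat -> T, (forall n, D (u n)) ->
    exists2 phi : nat -> nat, {homo phi : m n / (m < n)%N} &
      cover_compact (closure (range (u \o phi)))) ->
  forall u : nat -> T, (forall n, D (u n) \/ u n = y) ->
    exists2 phi : nat -> nat, {homo phi : m n / (m < n)%N} &
      exists K, [/\ closed K, compact K & forall n, K (u (phi n))].
Proof.
move=> T1 Dsub u Du.
have [/frequently_subsequence[phi phiS uy]|/existsNP[N uNy]] :=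
  pselect (forall N, exists n, (N <= n)%N /\ u n = y).
  exists phi => //; exists [set y]; split => //.
    exact: accessible_closed_set1.
  exact: compact_set1.
have DN n : D (u (N + n)%N).
  have [//|uy] := Du (N + n)%N; case: uNy.
  by exists (N + n)%N; rewrite leq_addr.
have [phi phiS cK] := Dsub (fun n => u (N + n)%N) DN.
exists (fun n => (N + phi n)%N) => [m n /phiS|]; first by rewrite ltn_add2l.
exists (closure (range (u \o (fun n => N + phi n)%N))); split.
- exact: closed_closure.
- exact/compact_iff_cover_compact.
by move=> n; apply: subset_closure; exists n.
Qed.

Section product.
Variables (A : Type) (X : A -> topologicalType).

Lemma nbhs_prod_topology (x : prod_topology X) (O : set (prod_topology X)) :
  nbhs x O ->
  exists2 S : set A, finite_set S &
    exists2 U : forall a, set (X a), forall a, nbhs (x a) (U a) &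
      [set z : prod_topology X | forall a, S a -> U a (z a)] `<=` O.
Proof.
pose G : set_system (prod_topology X) := fun O =>
  exists2 S : set A, finite_set S &
    exists2 U : forall a, set (X a), forall a, nbhs (x a) (U a) &
      [set z : prod_topology X | forall a, S a -> U a (z a)] `<=` O.
have GF : Filter G.
  split.
  - by exists set0 => //; exists (fun=> setT) => // a; exact: filterT.
  - move=> P Q [S fS [U xU UP]] [S' fS' [U' xU' UQ]].
    exists (S `|` S'); first by rewrite finite_setU.
    exists (fun a => U a `&` U' a) => [a|z Uz]; first exact: filterI.
    by split; [apply: UP|apply: UQ] => a Sa; have [] := Uz a _ => //; [left|right].
  - move=> P Q PQ [S fS [U xU UP]]; exists S => //; exists U => //.
    exact: subset_trans PQ.
(* The product topology is a supremum of initial topologies, so convergence of [G] is checked on one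
   coordinate [i] at a time. *)
suff : G --> x by apply.
apply/cvg_sup => i E [_ [[V oV <-] Vx] VE].
exists [set i]; first exact: finite_set1.
(* This is [V], transported along [e], at coordinate [i], and the whole space elsewhere. *)
exists (fun a => [set t | forall e : a = i, V (ecast j (X j) e t)]) => [a|z Uz].
  have [e|ne] := pselect (a = i); last by apply: nearW => t e; case: (ne e).
  case: i / e V oV Vx {VE} => V oV Vx.
  have : nbhs (x a) V by exact: open_nbhs_nbhs.
  by apply: filterS => t Vt e; rewrite (Prop_irrelevance e erefl).
by apply: VE; exact: (Uz i erefl erefl).
Qed.

Lemma box_compact (K : forall a, set (X a)) :
  (forall a, compact (K a)) ->
  compact ([set x | forall a, K a (x a)] : set (prod_topology X)).
Proof. exact: (@tychonoff {classic A} X). Qed.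

Lemma box_closed (K : forall a, set (X a)) :
  (forall a, closed (K a)) ->
  closed ([set x | forall a, K a (x a)] : set (prod_topology X)).
Proof.
move=> cK; have -> : [set x : prod_topology X | forall a, K a (x a)] =
    \bigcap_a ((fun x : prod_topology X => x a) @^-1` K a).
  by apply/seteqP; split=> [x Kx a _|x Kx a]; [exact: Kx|exact: (Kx a I)].
apply: closed_bigI => a _.
apply: (@preimage_closed _ _ (fun x : prod_topology X => x a)); last exact: cK.
by move=> x _; exact: (@proj_continuous {classic A} X a).
Qed.

Variables (D : forall a, set (X a)) (y : prod_topology X).
Arguments D : clear implicits.

Definition sigma_core : set (prod_topology X) :=
  [set x | countable [set a | x a <> y a] /\ forall a, D a (x a) \/ x a = y a].

Lemma sigma_core_dense : (forall a, dense (D a)) -> dense sigma_core.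
Proof.
move=> Dd O [x Ox] oO.
have /nbhs_prod_topology[S fS [U xU UO]] : nbhs x O by exact: open_nbhs_nbhs.
(* Only the finitely many coordinates in [S] are constrained; elsewhere the new point copies [y]. *)
have zP a : exists t : X a, (S a -> U a t /\ D a t) /\ (~ S a -> t = y a).
  have [Sa|nSa] := pselect (S a); last by exists (y a).
  have := xU a; rewrite nbhsE => -[V [oV Vx] VU].
  have [t [Vt Dt]] := Dd a V (ex_intro _ _ Vx) oV.
  by exists t; split => // _; split => //; exact: VU.
pose z : prod_topology X := fun a => projT1 (cid (zP a)).
have zS a : (S a -> U a (z a) /\ D a (z a)) /\ (~ S a -> z a = y a).
  exact: projT2 (cid (zP a)).
exists z; split; first by apply: UO => a /(zS a).1[].
split=> [|a]; last first.
  by have [/(zS a).1[]|/(zS a).2] := pselect (S a); [left|right].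
apply/finite_set_countable/(sub_finite_set _ fS) => a zy.
by apply: contrapT => /(zS a).2.
Qed.

Hypothesis T1X : forall a, accessible_space (X a).
Hypothesis Dsub : forall a (u : nat -> X a), (forall n, D a (u n)) ->
  exists2 phi : nat -> nat, {homo phi : m n / (m < n)%N} &
    cover_compact (closure (range (u \o phi))).

Lemma sigma_core_compact_box (u : nat -> prod_topology X) :
  (forall n, sigma_core (u n)) ->
  exists2 theta : nat -> nat, {homo theta : m n / (m < n)%N} &
    exists K : set (prod_topology X),
      [/\ closed K, compact K, forall n, K (u (theta n)) &
        forall x, K x -> countable [set a | x a <> y a]].
Proof.
move=> uC.
pose S := \bigcup_n [set a | u n a <> y a].
have cS : countable S by apply: bigcup_countable => // n _; have [] := uC n.
have uS n a : ~ S a -> u n a = y a.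
  by move=> nSa; apply: contrapT => ua; apply: nSa; exists n.
have /countable_injP[f f_inj] := cS.
(* As [f] is injective on [S], stage [k] of the diagonal argument treats at most one coordinate. *)
pose P k (phi : nat -> nat) := forall a, S a -> f a = k ->
  exists K : set (X a), [/\ closed K, compact K & forall n, K (u (phi n) a)].
have [k phi phiS|theta thetaS thetaP] := @diagonal_subsequence P.
  have [[a [Sa fa]]|nak] := pselect (exists a, S a /\ f a = k); last first.
    by exists id => // a Sa fa; case: nak; exists a.
  have [n|psi psiS [K KP]] := @add_point_compact_subsequence _ (D a) (y a)
    (@T1X a) (@Dsub a) (fun n => u (phi n) a).
    by have [_] := uC (phi n); exact.
  exists psi => // b Sb fb; have -> : b = a by apply: f_inj; rewrite ?inE ?fb.
  by exists K.
exists theta => //.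
have Kex a : exists K : set (X a), [/\ closed K, compact K,
    forall n, K (u (theta n) a) & ~ S a -> K = [set y a]].
  have [Sa|nSa] := pselect (S a); last first.
    exists [set y a]; split => //; last by move=> n; exact: uS.
      exact: accessible_closed_set1 (@T1X a) _.
    exact: compact_set1.
  have [phi /(_ a Sa erefl)[K [clK cK uK]] phiP] := thetaP (f a).
  (* The terms with index at most [f a], which the diagonal argument leaves uncontrolled. *)
  pose E := [set u (theta n) a | n in `I_(f a).+1].
  have fE : finite_set E by apply: finite_image; exact: finite_II.
  exists (K `|` E); split => // [||n].
  - by apply: closedU => //; exact: (accessible_finite_set_closed.1 (@T1X a)).
  - by apply: compactU => //; exact: finite_compact.
  - have [nf|/phiP[m _ <-]] := leqP n (f a); last by left; exact: uK.
    by right; exists n.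
pose K a := projT1 (cid (Kex a)).
have KP a : [/\ closed (K a), compact (K a),
    forall n, K a (u (theta n) a) & ~ S a -> K a = [set y a]].
  exact: projT2 (cid (Kex a)).
exists [set x | forall a, K a (x a)]; split.
- by apply: box_closed => a; have [] := KP a.
- by apply: box_compact => a; have [] := KP a.
- by move=> n a; have [_ _ +] := KP a; exact.
- move=> x Kx; apply: sub_countable cS; apply: subset_card_le => a xy.
  apply: contrapT => nSa; have [_ _ _ /(_ nSa) Ky] := KP a.
  by apply: xy; have := Kx a; rewrite Ky.
Qed.

End product.

Theorem proposition2p2 (A : Type) (X : A -> topologicalType)
    (pracompactX : forall a, totally_countably_pracompact (X a))
    (T1X : forall a, accessible_space (X a)) :
  totally_countably_pracompact (prod_topology X) /\
  (forall Y : set (prod_topology X), is_sigma_product Y ->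
     totally_countably_pracompact (set_type Y)).
Proof.
pose D a := s2val (cid2 (pracompactX a)).
have Dd a : dense (D a) by exact: s2valP (cid2 (pracompactX a)).
have Dsub := fun a => s2valP' (cid2 (pracompactX a)).
split.
  (* Any base point [y] serves; if there is none, the product is empty and admits no sequences. *)
  have [[y _]|X0] := pselect ([set: prod_topology X] !=set0); last first.
    by exists set0 => [O [x _]|u /(_ 0%N)//]; case: X0; exists x.
  exists (sigma_core D y) => [|u uC]; first exact: sigma_core_dense.
  have [theta thetaS [K [clK cK uK _]]] := sigma_core_compact_box T1X Dsub uC.
  exists theta => //; apply/compact_iff_cover_compact.
  apply: subclosed_compact cK _; first exact: closed_closure.
  by rewrite closureE; apply: smallest_sub => // _ [n _ <-]; exact: uK.
move=> Y [y YE].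
exists (set_val @^-1` sigma_core D y) => [O [x Ox] [O' oO' O'E]|u uC].
  have [|z [O'z Cz]] := @sigma_core_dense _ _ D y Dd O' _ oO'.
    by exists (set_val x); move: Ox; rewrite -O'E.
  have Yz : z \in Y by rewrite inE YE; case: Cz.
  by exists (exist _ z Yz : Y); split => //; rewrite -O'E.
have [theta thetaS [K [clK cK uK KY]]] := sigma_core_compact_box T1X Dsub uC.
exists theta => //; apply/compact_iff_cover_compact.
(* Since [K] lies inside [Y], its trace is compact and closed in [Y], and so bounds the closure
   taken in [Y]. *)
have KsubY : K `<=` Y by move=> x Kx; rewrite YE; exact: KY.
apply: subclosed_compact (compact_set_val KsubY cK) _.
  exact: closed_closure.
rewrite closureE; apply: smallest_sub => [|_ [n _ <-]]; last exact: uK.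
by apply: preimage_closed => // x _; exact: initial_continuous.
Qed.
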